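(* Let $X$ be a complex Banach space and let $T$ be a hypercyclic bounded linear operator on $X$. Then for every $x\in HC(T)$ there exists a residual subset $\mathcal B$ of $\mathbb T^{\mathbb N}$ such that for every $(\lambda_1,\lambda_2,\dots)\in \mathcal B$ the set $\{\lambda_n T^n x;\ n\geq 1\}$ is dense in $X$.
   Context: $\mathbb T$ is the unit circle in $\mathbb C$. $\mathbb T^{\mathbb N}$ (sequences indexed by $n\geq 1$) is endowed with the complete metric $d(\Lambda,M)=\sum_{n=1}^{+\infty}\frac{|\lambda_n-\mu_n|}{2^n}$ for $\Lambda=(\lambda_n)$, $M=(\mu_n)$. Residual means comeager (the complement is of first category). $HC(T)$ is the set of hypercyclic vectors for $T$, i.e. vectors $x\in X$ such that $\{T^n x;\ n\geq 0\}$ is dense in $X$; $T$ is hypercyclic if $HC(T)\neq\emptyset$. *)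

(* Defs.v *)
From HB Require Import structures.
From mathcomp Require Import all_boot all_order all_algebra.
From mathcomp Require Import complex.
From mathcomp Require Import all_classical all_reals all_analysis.
Set Implicit Arguments.
Unset Strict Implicit.
Unset Printing Implicit Defensive.
Import Order.TTheory GRing.Theory Num.Theory.
Import numFieldNormedType.Exports.
Local Open Scope classical_set_scope.
Local Open Scope complex_scope.
Local Open Scope ring_scope.

Definition nowhere_dense (T : topologicalType) (A : set T) : Prop :=
  interior (closure A) = set0.

Definition first_category (T : topologicalType) (A : set T) : Prop :=
  exists F : nat -> set T,
    (forall i, nowhere_dense (F i)) /\ A = \bigcup_i F i.

Definition residual (T : topologicalType) (B : set T) : Prop :=
  first_category (~` B).

Definition circle (R : realType) : Type := {z : R[i] | `|z| == 1}.

(* The sequences (lambda_1, lambda_2, ...) are indexed by n >= 1, the functions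
   below by n >= 0: [lam n] is lambda_(n+1). *)
Definition circle_seq (R : realType) : Type := nat -> circle R.

HB.instance Definition _ (R : realType) := gen_eqMixin (circle_seq R).
HB.instance Definition _ (R : realType) := gen_choiceMixin (circle_seq R).

(* [Normc.normc] is the modulus as an element of R, whereas the norm `|z| of
   z : R[i] is an element of R[i]. *)
Definition circle_term (R : realType) (lam mu : circle_seq R) : R^nat :=
  fun n => Normc.normc (val (lam n) - val (mu n)) / 2 ^+ n.+1.

Definition circle_dist (R : realType) (lam mu : circle_seq R) : R :=
  limn (series (circle_term lam mu)).

Section circle_metric.
Variable R : realType.
Implicit Types lam mu nu : circle_seq R.

Lemma circle_normc (z : circle R) : Normc.normc (val z) = 1.
Proof.
by case: z => -[a b] /= /eqP; rewrite normc_def => /(congr1 (@complex.Re R)).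
Qed.

Lemma circle_term_ge0 lam mu n : 0 <= circle_term lam mu n.
Proof.
rewrite divr_ge0 ?exprn_ge0//.
by case: (val (lam n) - val (mu n)) => a b; exact: sqrtr_ge0.
Qed.

Lemma circle_term_cvg lam mu : cvgn (series (circle_term lam mu)).
Proof.
have h : cvgn (series (geometric (1 : R) 2^-1)).
  by apply: is_cvg_geometric_series; rewrite ger0_norm ?invr_ge0// invf_lt1 ?ltr1n.
apply: (series_le_cvg _ _ _ h) => n.
- exact: circle_term_ge0.
- by rewrite /geometric/= mul1r exprn_ge0// invr_ge0.
- rewrite /geometric/= /circle_term mul1r exprS invfM mulrA exprVn.
  rewrite -[leRHS]mul1r ler_wpM2r ?invr_ge0 ?exprn_ge0//.
  rewrite ler_pdivrMr// mul1r (le_trans (le_normcD _ _))// normcN.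
  by rewrite !circle_normc.
Qed.

Lemma circle_dist_xx lam : circle_dist lam lam = 0.
Proof.
have -> : circle_dist lam lam = limn (fun=> 0 : R).
  congr (limn _); apply/funext => n; rewrite /series/= big1// => k _.
  by rewrite /circle_term subrr Normc.normc0 mul0r.
exact: lim_cst.
Qed.

Lemma circle_dist_eq0 lam mu : circle_dist lam mu = 0 -> lam = mu.
Proof.
move=> d0; apply/funext => n; apply/val_inj/eqP; rewrite -subr_eq0.
apply/eqP/Normc.eq0_normc/eqP.
have t0 : circle_term lam mu n <= 0.
  rewrite -d0; apply: (@le_trans _ _ (series (circle_term lam mu) n.+1)).
    rewrite /series/= big_nat_recr//= lerDr sumr_ge0// => k _.
    exact: circle_term_ge0.
  apply: nondecreasing_cvgn_le; last exact: circle_term_cvg.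
  by apply/nondecreasing_series => k _ _; exact: circle_term_ge0.
have /eqP : circle_term lam mu n = 0.
  by apply/eqP; rewrite eq_le t0 circle_term_ge0.
by rewrite /circle_term mulf_eq0 invr_eq0 expf_eq0/= pnatr_eq0 orbF.
Qed.

Lemma circle_dist_sym lam mu : circle_dist lam mu = circle_dist mu lam.
Proof.
congr (limn (series _)); apply/funext => n.
by rewrite /circle_term -normcN opprB.
Qed.

Lemma circle_dist_triangle mu lam nu :
  circle_dist lam nu <= circle_dist lam mu + circle_dist mu nu.
Proof.
have c1 := @circle_term_cvg lam mu; have c2 := @circle_term_cvg mu nu.
rewrite /circle_dist -lim_seriesD//; apply: lim_series_le.
- exact: circle_term_cvg.
- exact: is_cvg_seriesD.
- move=> n; rewrite /circle_term fctE -mulrDl ler_wpM2r ?invr_ge0 ?exprn_ge0//.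
  rewrite (_ : val (lam n) - val (nu n) =
    (val (lam n) - val (mu n)) + (val (mu n) - val (nu n))) ?le_normcD//.
  by rewrite addrA subrK.
Qed.

End circle_metric.

HB.instance Definition _ (R : realType) :=
  @isMetric.Build R (circle_seq R) (@circle_dist R)
    (@circle_dist_xx R) (@circle_dist_eq0 R) (@circle_dist_sym R)
    (@circle_dist_triangle R).

Definition bounded_operator (K : numFieldType) (V W : normedModType K)
    (T : {linear V -> W}) : Prop :=
  exists2 M : K, 0 <= M & forall v, `|T v| <= M * `|v|.

Lemma bounded_operatorP (K : numFieldType) (V W : normedModType K)
    (T : {linear V -> W}) : bounded_operator T <-> continuous T.
Proof.
rewrite -linear_bounded_continuous linear_boundedP; split.
  move=> [M M0 TM]; exists M; split; first exact: ger0_real.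
  by move=> r /ltW Mr v; rewrite (le_trans (TM v))// ler_wpM2r.
by move=> /pinfty_ex_gt0[M M0 TM]; exists M => //; exact: ltW.
Qed.

Definition HC (K : numFieldType) (X : normedModType K) (T : X -> X) : set X :=
  [set x | dense (range (fun n : nat => iter n T x))].

Definition hypercyclic (K : numFieldType) (X : normedModType K) (T : X -> X) :
  Prop := HC T !=set0.

(* Main.v *)
Require Import Defs.
From HB Require Import structures.
From mathcomp Require Import all_boot all_order all_algebra.
From mathcomp Require Import complex.
From mathcomp Require Import all_classical all_reals all_analysis.
Set Implicit Arguments.
Unset Strict Implicit.
Unset Printing Implicit Defensive.
Import Order.TTheory GRing.Theory Num.Theory.
Import numFieldNormedType.Exports.
Local Open Scope classical_set_scope.
Local Open Scope complex_scope.
Local Open Scope ring_scope.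

(** For a non-empty open subset [U] of the space, a sequence [lam] is good for
    [U] when some [lam n *: T^(n+1) x] lies in [U]. Goodness for [U] is an open
    condition, since each coordinate is a continuous function of [lam]
    ([open_hits]). It is also a dense one ([dense_hits]): moving one coordinate
    of high index [n] hardly changes [lam] for the distance of the circle
    sequences, and setting that coordinate to [1] is enough as soon as
    [T^(n+1) x] lies in [U]; such indices [n] exist beyond any bound, because
    the tails of a dense sequence in a normed space are dense ([dense_tail]).

    The orbit of [x] being dense, countably many non-empty open sets are enough
    to test density in the space ([countable_pi_base]): the sequences that are
    good for all of them form a countable intersection of dense open sets, which
    is residual ([residual_bigcap]), and they all have dense rotated orbits. *)

Lemma residual_bigcap (T : topologicalType) (I : countType) (O : I -> set T) :
  (forall i, open (O i)) -> (forall i, dense (O i)) ->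
  residual (\bigcap_i O i).
Proof.
move=> Oop Od.
exists (fun n => if unpickle n is Some i then ~` O i else set0); split.
  move=> n; case: (unpickle n) => [i|].
    rewrite /nowhere_dense -subset0 => t.
    rewrite -(closure_id _).1; last exact: open_closedC.
    move=> tO; have [] := Od i ((~` O i)^°).
    - by exists t.
    - exact: open_interior.
    - by move=> y [/interior_subset].
  by rewrite /nowhere_dense closure0 interior0.
rewrite setC_bigcap; apply/seteqP; split => [t [i _ nOt]|t [n _]].
  by exists (pickle i) => //; rewrite pickleK.
by case: (unpickle n) => [i nOt|//]; exists i.
Qed.

(** Radii of balls in a complex normed space are elements of [R[i]]; a positive
    one is real, so it dominates some [1 / (j + 1)], which makes countably many
    radii sufficient. *)
Lemma complex_archimedean (R : realType) (e : R[i]) : 0 < e ->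
  exists j : nat, j.+1%:R^-1 < e.
Proof.
case: e => a b; rewrite ltcE/= => /andP[/eqP -> a0].
have [j] := ltr_add_invr a0; rewrite add0r => ja; exists j.
by rewrite -(rmorph_nat (real_complex R)) -fmorphV ltcE/= eqxx ja.
Qed.

(** The balls of radii [1 / (j + 1)] around the terms of the sequence will do.
    Such a family [V] is a pi-base: to be dense, a set only has to meet all of
    its members. *)
Lemma countable_pi_base (R : realType) (X : normedModType R[i]) (u : nat -> X) :
  dense (range u) ->
  exists V : nat * nat -> set X,
    [/\ forall i, open (V i), forall i, V i !=set0 &
        forall U, U !=set0 -> open U -> exists i, V i `<=` U].
Proof.
move=> ud; exists (fun i => (ball (u i.1) i.2.+1%:R^-1)^°); split.
- by move=> i; exact: open_interior.
- by move=> i; exists (u i.1); apply: nbhsx_ballx; rewrite invr_gt0.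
move=> U [v Uv] Uo.
have /nbhs_ballP[e /= e0 vU] : nbhs v U by exact: open_nbhs_nbhs.
(* Half the radius: the center of the small ball is only known to lie within
   [1 / (j + 1)] of [v]. *)
have [j je] : exists j : nat, j.+1%:R^-1 < e / 2.
  by apply: complex_archimedean; rewrite divr_gt0.
have j0 : (0 : R[i]) < j.+1%:R^-1 by rewrite invr_gt0.
have [] := ud ((ball v j.+1%:R^-1)^°).
- by exists v; exact: nbhsx_ballx.
- exact: open_interior.
move=> w [/interior_subset vw [k _ kw]]; rewrite -{w}kw in vw.
exists (k, j) => y /= /interior_subset ky; apply: vU.
by apply: (ball_split (z := u k)); exact: le_ball (ltW je) _ _.
Qed.

(** An isolated point [p] fills a normed space: [p + t *: (y - p)] tends to [p]
    as [t] tends to [0], hence equals [p] for some non-zero [t]. *)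
Lemma open_set1_trivial (K : numFieldType) (X : normedModType K) (p : X) :
  open [set p] -> forall y, y = p.
Proof.
move=> po y; apply/eqP; rewrite -subr_eq0.
have c : (fun t : K => p + t *: (y - p)) t @[t --> (0 : K)] --> p.
  have c0 : (fun t : K => t *: (y - p)) t @[t --> (0 : K)] --> 0 *: (y - p).
    exact: (@cvgZr_tmp _ _ K (nbhs (0 : K)) _ id 0 (y - p)).
  have := cvgD (cvg_cst p) c0; rewrite scale0r addr0; exact.
have : \forall t \near (0 : K), p + t *: (y - p) = p.
  by apply: (c [set p]); exact: open_nbhs_nbhs.
move=> /nbhs_ballP[e /= e0] /(_ (e / 2)).
rewrite -ball_normE/= sub0r normrN gtr0_norm ?divr_gt0// => /(_ _).
rewrite ltr_pdivrMr// ltr_pMr// ltr1n => /(_ isT)/eqP.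
rewrite addrC -subr_eq0 addrK scaler_eq0 mulf_eq0 invr_eq0.
by rewrite (gt_eqF e0) pnatr_eq0.
Qed.

(** Deleting one term of the sequence at a time keeps it dense, because a
    non-empty open set stays open and non-empty after the removal of a point,
    unless it is reduced to this point; in that case the space is trivial, and
    every term of the sequence will do. *)
Lemma dense_tail (K : numFieldType) (X : normedModType K) (u : nat -> X) :
  dense (range u) ->
  forall N U, U !=set0 -> open U -> exists2 n, (N <= n)%N & U (u n).
Proof.
move=> ud; elim=> [|N IH] U U0 Uo.
  by have [w [Uw [n _ nw]]] := ud U U0 Uo; exists n; rewrite // nw.
have [[y [Uy yN]]|noy] := pselect (exists y, U y /\ y <> u N).
  have [||n Nn [Un nN]] := IH (U `&` ~` [set u N]).
  - by exists y.
  - apply: openI => //; apply: closed_openC; apply: accessible_closed_set1.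
    exact/hausdorff_accessible/norm_hausdorff.
  exists n => //; rewrite ltn_neqAle Nn andbT; apply/eqP => E.
  by apply: nN; rewrite /= E.
have UE : U = [set u N].
  have UN y : U y -> y = u N.
    by move=> Uy; apply: contrapT => yN; apply: noy; exists y.
  apply/seteqP; split => // _ ->.
  by case: U0 => y Uy; rewrite -(UN y Uy).
exists N.+1 => //; rewrite (open_set1_trivial _ (u N.+1) (p := u N)) -?UE//.
by rewrite UE.
Qed.

Section circle_seq_topology.
Variable R : realType.
Implicit Types lam mu : circle_seq R.

Lemma circle_term_le_dist lam mu n : circle_term lam mu n <= circle_dist lam mu.
Proof.
apply: (@le_trans _ _ (series (circle_term lam mu) n.+1)).
  rewrite /series/= big_nat_recr//= lerDr sumr_ge0// => k _.
  exact: circle_term_ge0.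
apply: nondecreasing_cvgn_le; last exact: circle_term_cvg.
by apply/nondecreasing_series => k _ _; exact: circle_term_ge0.
Qed.

Lemma circle_coord_continuous n :
  continuous (fun lam : circle_seq R =>
    val (lam n) : (R[i] : numFieldType)).
Proof.
move=> lam; apply/(@cvgrPdist_lt _ _ _ (nbhs lam)) => -[a b].
rewrite ltcE/= => /andP[/eqP -> a0].
have r0 : 0 < a / 2 ^+ n.+1 by rewrite divr_gt0 ?exprn_gt0.
apply/metricType_numDomainType.nbhs_mdistP.
exists (a / 2 ^+ n.+1) => // mu /= lm.
rewrite normc_def ltcE/= eqxx/=.
have := le_lt_trans (circle_term_le_dist lam mu n) lm.
by rewrite /circle_term ltr_pM2r ?invr_gt0 ?exprn_gt0//; case: (_ - _).
Qed.

(** The distance reduces to its [n]-th term, which is at most [2 / 2 ^ (n + 1)]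
    because the unit circle has diameter [2]. *)
Lemma circle_dist_dfwith lam n (z : circle R) :
  circle_dist lam (dfwith lam n z) <= 2^-1 ^+ n.
Proof.
apply: limr_le; first exact: circle_term_cvg.
apply: nearW => m; rewrite /series/=.
have tle k : circle_term lam (dfwith lam n z) k <= (k == n)%:R * 2^-1 ^+ n.
  rewrite /circle_term; case: dfwithP => [|j].
    rewrite eqxx mul1r exprVn exprS invfM mulrA ler_piMl ?invr_ge0 ?exprn_ge0//.
    rewrite ler_pdivrMr// mul1r (le_trans (le_normcD _ _))// normcN.
    by rewrite !circle_normc.
  by rewrite eq_sym => /negbTE ->; rewrite subrr Normc.normc0 !mul0r.
rewrite (le_trans (ler_sum _ (fun k _ => tle k)))// -mulr_suml ler_piMl//.
rewrite -natr_sum -[leRHS]/(1%:R) ler_nat big_mkord.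
have [nm|mn] := ltnP n m; last first.
  by rewrite big1// => -[k /= km] _; rewrite (ltn_eqF (leq_trans km mn)).
rewrite (bigD1 (Ordinal nm))//= eqxx big1 ?addn0// => k.
by rewrite -val_eqE/= => /negbTE ->.
Qed.

End circle_seq_topology.

Section rotated_sequence.
Variables (R : realType) (X : normedModType R[i]) (u : nat -> X).

(** The index shift matches the convention that a circle sequence starts with
    the coefficient of [u 1]. *)
Definition hits (U : set X) : set (circle_seq R) :=
  [set lam | exists n, U (val (lam n) *: u n.+1)].

Lemma open_hits U : open U -> open (hits U).
Proof.
move=> Uo; rewrite (_ : hits U =
    \bigcup_n (fun lam : circle_seq R => val (lam n) *: u n.+1) @^-1` U).
  apply: bigcup_open => n _; apply: open_comp => // lam _.
  exact: (cvgZr_tmp (@circle_coord_continuous R n lam)).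
by apply/seteqP; split => lam [n]; exists n.
Qed.

Lemma dense_hits U : dense (range u) -> U !=set0 -> open U -> dense (hits U).
Proof.
move=> ud U0 Uo W [lam Wlam] Wo.
have /metricType_numDomainType.nbhs_mdistP[e /= e0 eW] : nbhs lam W.
  exact: open_nbhs_nbhs.
have [N _ Ne] : \forall n \near \oo, (2^-1 : R) ^+ n < e.
  have h : (fun n => (2^-1 : R) ^+ n) @ \oo --> (0 : R).
    by apply: cvg_expr; rewrite ger0_norm ?invr_ge0// invf_lt1 ?ltr1n.
  exact: (cvgr_lt 0 h).
(* Asking for an index at least [N + 1] makes it positive, so that it can be
   written [n.+1] with [N <= n]. *)
have [[//|n] Nn Un] := dense_tail ud N.+1 U0 Uo.
have one : `|1 : R[i]| == 1 by rewrite normr1.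
exists (dfwith lam n (exist _ 1 one)); split.
  apply: eW; rewrite /= (le_lt_trans (circle_dist_dfwith lam n _))//.
  exact: Ne.
by exists n; rewrite dfwithin/= scale1r.
Qed.

End rotated_sequence.

Theorem proposition5p4 (R : realType) (X : completeNormedModType R[i])
    (T : {linear X -> X}) (T_bounded : bounded_operator T)
    (T_hypercyclic : hypercyclic T) :
  forall x : X, HC T x ->
    exists B : set (circle_seq R), residual B /\
      forall lam : circle_seq R, B lam ->
        dense (range (fun n : nat => val (lam n) *: iter n.+1 T x)).
Proof.
move=> x xHC; have [V [Vo V0 Vbase]] := countable_pi_base xHC.
exists (\bigcap_i hits (fun n => iter n T x) (V i)); split.
  by apply: residual_bigcap => i; [exact: open_hits|exact: dense_hits].
move=> lam Blam U U0 Uo; have [i ViU] := Vbase U U0 Uo.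
have [n Vn] := Blam i I; exists (val (lam n) *: iter n.+1 T x).
by split; [exact: ViU | exists n].
Qed.
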